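(* Let $\gamma$ be a finite set of cells that is a translate of a Young diagram (French convention). For integers $e$ and $e'$, $Q^f_{(\gamma,e)}(X)=Q^f_{(\gamma,e')}(X)$. That is, the folded Q-function does not depend on the choice of the specialized diagonal.
   Context: Cells are pairs $(x,y)\in\mathbb Z^2$ (column $x$, row $y$, rows increasing upward). A folded diagram is a pair $(\gamma,e)$, where $\gamma$ is a translate of a Young diagram in French convention and $e\in\mathbb Z$ determines the specialized diagonal $\mathfrak d=\{(x,y):x-y=e\}$; this diagonal need not meet $\gamma$. A cell $(x,y)$ is weakly above $\mathfrak d$ if $x-y\le e$. A semi-standard folded tableau of shape $(\gamma,e)$ is a filling of the cells of $\gamma$ with letters of the marked alphabet $1'<1<2'<2<\cdots$ satisfying: - entries weakly increase from left to right along rows and from bottom to top along columns; - two cells in a common row that are both weakly above $\mathfrak d$ never contain the same unmarked letter; - two cells in a common row that are not both weakly above $\mathfrak d$ never contain the same marked letter; - two cells in a common column that are both weakly above $\mathfrak d$ never contain the same marked letter; - two cells in a common column that are not both weakly above $\mathfrak d$ never contain the same unmarked letter. The folded Q-function is $Q^f_{(\gamma,e)}(X)=\sum_S\prod_i x_i^{\#\{\text{cells of } S \text{ containing } i \text{ or } i'\}}$, summed over all semi-standard folded tableaux $S$ of shape $(\gamma,e)$. *)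

(* Defs.v *)
From mathcomp Require Import all_boot all_order all_algebra finmap.
From mathcomp Require Import boolp classical_sets functions cardinality fsbigop.

Set Implicit Arguments.
Unset Strict Implicit.
Unset Printing Implicit Defensive.

Import Order.TTheory GRing.Theory Num.Theory.

Local Open Scope classical_set_scope.
Local Open Scope ring_scope.

(* (column, row), rows increasing upward *)
Definition cell : Type := (int * int)%type.

(* The Young diagram of the partition lam, translated by (a, b); in French
   convention nth 0 lam i is the length of the i-th row from the bottom.
   The empty diagram is allowed. *)
Definition young_translate (gamma : {fset cell}) : Prop :=
  exists (lam : seq nat) (a b : int), sorted geq lam /\
    forall c : cell, c \in gamma <->
      exists i j : nat, (j < nth 0 lam i)%N /\ c = (a + j%:Z, b + i%:Z).

(* Indices start at 0: (i, false) is the marked letter (i+1)' and (i, true) is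
   the unmarked letter i+1. The lexicographic order, with false < true, is
   1' < 1 < 2' < 2 < ... *)
Definition letter : Type := (nat *l bool)%type.

Definition unmarked (l : letter) : bool := l.2.
Definition marked (l : letter) : bool := ~~ l.2.

Definition weakly_above (e : int) (c : cell) : bool := c.1 - c.2 <= e.

Definition same_row (c d : cell) : bool := c.2 == d.2.
Definition same_col (c d : cell) : bool := c.1 == d.1.

Definition filling (gamma : {fset cell}) : Type := {ffun gamma -> letter}.

Record semistandard_folded (gamma : {fset cell}) (e : int)
    (S : filling gamma) : Prop := {
  row_weak : forall c d : gamma, same_row (val c) (val d) ->
    (val c).1 <= (val d).1 -> (S c <= S d)%O;
  col_weak : forall c d : gamma, same_col (val c) (val d) ->
    (val c).2 <= (val d).2 -> (S c <= S d)%O;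
  row_above : forall c d : gamma, c != d -> same_row (val c) (val d) ->
    weakly_above e (val c) && weakly_above e (val d) ->
    ~ (S c = S d /\ unmarked (S c));
  row_not_above : forall c d : gamma, c != d -> same_row (val c) (val d) ->
    ~~ (weakly_above e (val c) && weakly_above e (val d)) ->
    ~ (S c = S d /\ marked (S c));
  col_above : forall c d : gamma, c != d -> same_col (val c) (val d) ->
    weakly_above e (val c) && weakly_above e (val d) ->
    ~ (S c = S d /\ marked (S c));
  col_not_above : forall c d : gamma, c != d -> same_col (val c) (val d) ->
    ~~ (weakly_above e (val c) && weakly_above e (val d)) ->
    ~ (S c = S d /\ unmarked (S c)) }.

(* Finitely supported exponents: m stands for the monomial
   \prod_i x_(i+1) ^ (m i). *)
Definition exponent : Type := {fsfun nat -> nat with 0%N}.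

(* Formal power series over int in the variables x_1, x_2, ..., given by
   their coefficients. *)
Definition power_series : Type := exponent -> int.

Definition monomial (m : exponent) : power_series := fun m' => (m' == m)%:R.

Definition content (gamma : {fset cell}) (S : filling gamma) : exponent :=
  [fsfun i in [fset (S c).1 | c : gamma]%fset => #|[pred c | (S c).1 == i]|].

Lemma contentE (gamma : {fset cell}) (S : filling gamma) (i : nat) :
  content S i = #|[pred c | (S c).1 == i]|.
Proof.
rewrite fsfunE; case: ifPn => // /imfsetP Ni.
apply/esym/eqP; apply/pred0P => c /=; apply/negP => /eqP Sc; apply: Ni.
by exists c.
Qed.

(* The sum over all tableaux of their monomials, coefficientwise. A sum
   \sum_(S \in A) F S over a set is the sum over the S in A with F S != 0 when
   these are finitely many, and 0 otherwise; the next lemma shows that they are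
   always finitely many here. *)
Definition folded_Q (gamma : {fset cell}) (e : int) : power_series := fun m =>
  \sum_(S \in [set S : filling gamma | semistandard_folded e S])
    monomial (content S) m.

Lemma finite_folded_Q (gamma : {fset cell}) (e : int) (m : exponent) :
  finite_set [set S : filling gamma |
    semistandard_folded e S /\ monomial (content S) m != 0].
Proof.
pose N := \max_(i <- finsupp m) i.
pose F (f : {ffun gamma -> 'I_N.+1 * bool}) : filling gamma :=
  [ffun c => ((f c).1 : nat, (f c).2) : letter].
apply: (@sub_finite_set _ _ (F @` setT)); last exact/finite_image/finite_finset.
move=> S /= [_]; rewrite /monomial; case: (m =P content S) => [mS _ | _]; last by rewrite eqxx.
have leN c : ((S c).1 < N.+1)%N.
  rewrite ltnS; apply: (@leq_bigmax_seq _ _ xpredT id) => //.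
  rewrite mem_finsupp mS contentE -lt0n; apply/card_gt0P; exists c.
  by rewrite inE.
exists [ffun c => (Ordinal (leN c), (S c).2)] => //.
by apply/ffunP => c; rewrite !ffunE /=; case: (S c).
Qed.

(* Main.v *)
Require Import Defs.
From mathcomp Require Import all_boot all_order all_algebra finmap.
From mathcomp Require Import boolp classical_sets functions cardinality fsbigop.
From mathcomp Require Import zify.

(** Fix the underlying numbers of a tableau. The cells carrying a given number
form ribbons, and for two adjacent cells of a ribbon, on diagonals d and d + 1,
the conditions determine the mark of exactly one of them: the first cell if
d + 1 <= e, the second otherwise. Hence each ribbon has exactly one free mark.
Passing from e to e + 1 only affects the adjacent pairs on the diagonals e and
e + 1, where the free mark moves from the first cell to the second: the
bijection replaces the marks (u, v) of such a pair by (~ v, u). *)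

Set Implicit Arguments.
Unset Strict Implicit.
Unset Printing Implicit Defensive.

Import Order.TTheory GRing.Theory Num.Theory.

Local Open Scope classical_set_scope.
Local Open Scope ring_scope.

(** * Diagonals, steps between adjacent cells, and convex sets of cells *)

Definition diag (c : cell) : int := c.1 - c.2.

(* Both directions lead to the next diagonal. *)
Definition step (o : bool) (c : cell) : cell :=
  if o then (c.1 + 1, c.2) else (c.1, c.2 - 1).

Definition back (o : bool) (c : cell) : cell :=
  if o then (c.1 - 1, c.2) else (c.1, c.2 + 1).

Definition north_east (c : cell) : cell := (c.1 + 1, c.2 + 1).

Lemma stepK o : cancel (step o) (back o).
Proof. by case: o => -[x y]; rewrite /step /back /=; congr pair; lia. Qed.

Lemma backK o : cancel (back o) (step o).
Proof. by case: o => -[x y]; rewrite /step /back /=; congr pair; lia. Qed.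

Lemma diag_step o c : diag (step o c) = diag c + 1.
Proof. by case: o; rewrite /diag /step /=; lia. Qed.

Lemma letter_leE (l l' : letter) :
  (l <= l')%O = (l.1 < l'.1)%N || (l.1 == l'.1) && (l.2 ==> l'.2).
Proof.
case: l l' => [n u] [n' u']; rewrite Order.ProdLexiOrder.lexi_pair /= !leEnat.
by case: u u' => -[]; lia.
Qed.

Lemma letter_le1 (l l' : letter) : (l <= l')%O -> (l.1 <= l'.1)%N.
Proof. by rewrite letter_leE => /orP[/ltnW//|/andP[/eqP->]]. Qed.

(** Convexity for the componentwise order: it supplies the cells between two cells of a row or
    column, and the two other corners of a unit square. *)
Definition interval_closed (gamma : {fset cell}) : Prop :=
  forall c d u : cell, c \in gamma -> d \in gamma ->
    c.1 <= u.1 <= d.1 -> c.2 <= u.2 <= d.2 -> u \in gamma.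

(** Row lengths weakly decrease upward, so the row of [u], being no higher than that of [d], is long
    enough to reach [u]; the cell [c] keeps [u] from lying left of or below the diagram. *)
Lemma young_translate_interval_closed gamma :
  young_translate gamma -> interval_closed gamma.
Proof.
move=> [lam [a [b [lam_sorted gammaE]]]] c d [x y] /gammaE[i [j [_ ->]]].
move=> /gammaE[i' [j' [ltj' ->]]] /= Hx Hy; apply/gammaE.
exists `|y - b|%N, `|x - a|%N; split; last by congr pair; lia.
(* Past the end of [lam] the default length is 0, and no [j'] is below 0. *)
have lti' : (i' < size lam)%N.
  by case: (ltnP i' (size lam)) => // le_i; rewrite nth_default in ltj'.
have ley : (`|y - b| <= i')%N by lia.
have geq_trans : transitive geq := rev_trans leq_trans.
have := sorted_leq_nth geq_trans leqnn 0%N lam_sorted.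
move=> /(_ `|y - b|%N i' (leq_ltn_trans ley lti') lti' ley) /=; lia.
Qed.

(** * Tableau conditions restricted to adjacent cells *)

Section LocalConditions.
Variable gamma : {fset cell}.
Implicit Types (f : cell -> letter) (S : filling gamma) (e : int).

(* Outside of [gamma] the value is junk. *)
Definition entry S (c : cell) : letter :=
  if insub c is Some u then S u else (0%N, false).

Lemma entry_val S (u : gamma) : entry S (val u) = S u.
Proof. by rewrite /entry valK. Qed.

(** A step raises the diagonal, so both cells are weakly above the specialized diagonal exactly when
    the second is. On equal numbers the order leaves three pairs of marks and the folded rule
    removes one of them; the two that remain share the mark prescribed here. *)
Definition locally_folded e f : Prop :=
  forall o c, c \in gamma -> step o c \in gamma ->
    (if o then (f c).1 <= (f (step o c)).1 else (f (step o c)).1 <= (f c).1)%N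
    /\ ((f c).1 = (f (step o c)).1 ->
        if diag (step o c) <= e then (f c).2 = ~~ o else (f (step o c)).2 = o).

Lemma semistandard_locally_folded e S :
  semistandard_folded e S -> locally_folded e (entry S).
Proof.
case=> rw cw ra rna ca cna o c cg sg.
pose u : gamma := [` cg]%fset; pose v : gamma := [` sg]%fset.
rewrite -[c]/(val u) -[step _ _]/(val v) !entry_val /=.
have neq_uv : u != v.
  apply/eqP => /(congr1 val) /(congr1 diag) /eqP.
  by rewrite /= diag_step; lia.
have neq_vu : v != u by rewrite eq_sym.
rewrite /diag; case: o => /= in sg v neq_uv neq_vu *.
  have row_uv : same_row (val u) (val v) by rewrite /same_row.
  have := rw u v row_uv ltac:(rewrite /=; lia).
  have := ra u v neq_uv row_uv; have := rna u v neq_uv row_uv.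
  rewrite /weakly_above /= letter_leE /marked /unmarked.
  case: (S u) (S v) => [n s] [n' s'] /= Hna Ha le_uv; split; first lia.
  move=> nn'; subst n'; case: ifP => le_e.
    case: s s' Ha {Hna} le_uv => -[] //= H; rewrite ?ltnn ?eqxx // => _.
    by case: H => //; lia.
  case: s s' Hna {Ha} le_uv => -[] //= H; rewrite ?ltnn ?eqxx // => _.
  by case: H => //; lia.
(* The step goes down, so [v] is the lower cell and carries the smaller letter. *)
have col_vu : same_col (val v) (val u) by rewrite /same_col.
have := cw v u col_vu ltac:(rewrite /=; lia).
have := ca v u neq_vu col_vu; have := cna v u neq_vu col_vu.
rewrite /weakly_above /= letter_leE /marked /unmarked.
case: (S u) (S v) => [n s] [n' s'] /= Hna Ha le_uv; split; first lia.
move=> nn'; subst n'; case: ifP => le_e.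
  case: s s' Ha {Hna} le_uv => -[] //= H; rewrite ?ltnn ?eqxx // => _.
  by case: H => //; lia.
case: s s' Hna {Ha} le_uv => -[] //= H; rewrite ?ltnn ?eqxx // => _.
by case: H => //; lia.
Qed.

Hypothesis gamma_closed : interval_closed gamma.

(** * From adjacent cells to whole rows and columns *)

Section LocalToGlobal.
Variables (e : int) (f : cell -> letter).
Hypothesis ff : locally_folded e f.

(** When the numbers tie, the determined mark makes either the smaller side marked or the larger
    side unmarked, and each of these gives the order. *)
Lemma locally_folded_le o c : c \in gamma -> step o c \in gamma ->
  if o then (f c <= f (step o c))%O else (f (step o c) <= f c)%O.
Proof.
move=> cg sg; have := ff cg sg; rewrite !letter_leE.
case: (f c) (f (step o c)) => [n s] [n' s'] /=.
by case: o {sg} => -[le_n]; case: (n =P n') => [-> /(_ erefl)|];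
  do ?case: ifP => _; do ?move=> ->; rewrite ?eqxx ?implybT ?orbT //; lia.
Qed.

Lemma locally_folded_row_le (x y : int) (k : nat) : (x, y) \in gamma ->
  (x + k%:Z, y) \in gamma -> (f (x, y) <= f (x + k%:Z, y))%O.
Proof.
elim: k => [|k IHk] cg dg; first by rewrite addr0.
have mg : (x + k%:Z, y) \in gamma by apply: (gamma_closed cg dg) => /=; lia.
apply: le_trans (IHk cg mg) _.
have E : (x + k.+1%:Z, y) = step true (x + k%:Z, y).
  by rewrite /step /=; congr pair; lia.
by rewrite E in dg *; apply: (locally_folded_le mg dg).
Qed.

Lemma locally_folded_col_le (x y : int) (k : nat) : (x, y) \in gamma ->
  (x, y + k%:Z) \in gamma -> (f (x, y) <= f (x, y + k%:Z))%O.
Proof.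
elim: k => [|k IHk] cg dg; first by rewrite addr0.
have mg : (x, y + k%:Z) \in gamma by apply: (gamma_closed cg dg) => /=; lia.
apply: le_trans (IHk cg mg) _.
have E : (x, y + k%:Z) = step false (x, y + k.+1%:Z).
  by rewrite /step /=; congr pair; lia.
by rewrite E in mg *; apply: (locally_folded_le dg mg).
Qed.

(** Monotonicity squeezes all numbers between the two cells to one value. If the right cell is
    weakly above the diagonal, the step out of the left cell determines its mark; otherwise the step
    into the right cell determines the common mark. *)
Lemma locally_folded_row_eq (x x' y : int) :
  (x, y) \in gamma -> (x', y) \in gamma ->
  x < x' -> f (x, y) = f (x', y) -> (f (x, y)).2 = ~~ (x' - y <= e).
Proof.
move=> cg dg lt_x eq_f.
case: (leP (x' - y) e) => le_e /=.
  have sg : step true (x, y) \in gamma.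
    by apply: (gamma_closed cg dg) => /=; lia.
  have [le_s Hs] := ff cg sg; rewrite /diag /= in Hs le_s.
  have E : (x', y) = (x + 1 + `|(x' - x - 1)%R|%N%:Z, y) by congr pair; lia.
  have := @locally_folded_row_le (x + 1) y `|(x' - x - 1)%R|%N sg.
  rewrite -E -eq_f => /(_ dg)/letter_le1 le_s'.
  by move: Hs; rewrite ifT; [apply; apply/anti_leq/andP|lia].
have sE : (x', y) = step true (x' - 1, y) by rewrite /step /=; congr pair; lia.
have bg : (x' - 1, y) \in gamma by apply: (gamma_closed cg dg) => /=; lia.
rewrite sE in dg; have [le_s Hs] := ff bg dg; rewrite -sE in dg Hs le_s.
have E : (x' - 1, y) = (x + `|(x' - x - 1)%R|%N%:Z, y) by congr pair; lia.
have := @locally_folded_row_le x y `|(x' - x - 1)%R|%N cg.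
rewrite -E => /(_ bg)/letter_le1 le_s'; rewrite eq_f.
move: Hs; rewrite /diag /= ifF; last lia.
by rewrite eq_f in le_s'; apply; apply/anti_leq/andP.
Qed.

(** The same squeeze in a column, where steps go down: the lower cell has the larger diagonal and
    decides the case. *)
Lemma locally_folded_col_eq (x y y' : int) :
  (x, y) \in gamma -> (x, y') \in gamma ->
  y < y' -> f (x, y) = f (x, y') -> (f (x, y)).2 = (x - y <= e).
Proof.
move=> cg dg lt_y eq_f.
case: (leP (x - y) e) => le_e /=.
  have sg : step false (x, y') \in gamma.
    by apply: (gamma_closed cg dg) => /=; lia.
  have [le_s Hs] := ff dg sg; rewrite /diag /= in Hs le_s.
  have E : (x, y' - 1) = (x, y + `|(y' - y - 1)%R|%N%:Z) by congr pair; lia.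
  have := @locally_folded_col_le x y `|(y' - y - 1)%R|%N cg.
  rewrite -E => /(_ sg)/letter_le1 le_s'; rewrite eq_f in le_s' *.
  by move: Hs; rewrite ifT; [apply; apply/anti_leq/andP|lia].
have sE : (x, y) = step false (x, y + 1) by rewrite /step /=; congr pair; lia.
have bg : (x, y + 1) \in gamma by apply: (gamma_closed cg dg) => /=; lia.
rewrite sE in cg; have [le_s Hs] := ff bg cg; rewrite -sE in cg Hs le_s.
have E : (x, y') = (x, y + 1 + `|(y' - y - 1)%R|%N%:Z) by congr pair; lia.
have := @locally_folded_col_le x (y + 1) `|(y' - y - 1)%R|%N bg.
rewrite -E -eq_f => /(_ dg)/letter_le1 le_s'.
move: Hs; rewrite /diag /= ifF; last lia.
by apply; apply/anti_leq/andP.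
Qed.

Definition square_free f := forall c, c \in gamma -> north_east c \in gamma ->
  (f c).1 <> (f (north_east c)).1.

(** Equal numbers at these two corners spread to the whole unit square. If its lower right corner is
    weakly above the diagonal, the two steps out of the upper left corner require it to be both
    marked and unmarked; otherwise the two steps into the lower right corner do so there. *)
Lemma locally_folded_square_free : square_free f.
Proof.
move=> [x y] cg ng eq_n; rewrite /north_east /= in ng eq_n.
have rg : (x + 1, y) \in gamma by apply: (gamma_closed cg ng) => /=; lia.
have ug : (x, y + 1) \in gamma by apply: (gamma_closed cg ng) => /=; lia.
have stepE c c' o : c' = step o c -> c \in gamma -> c' \in gamma ->
    (if o then (f c).1 <= (f c').1 else (f c').1 <= (f c).1)%N
    /\ ((f c).1 = (f c').1 ->
        if diag c' <= e then (f c).2 = ~~ o else (f c').2 = o).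
  by move=> ->; apply: ff.
have e1 : (x, y) = step false (x, y + 1) by rewrite /step /=; congr pair; lia.
have e2 : (x + 1, y) = step false (x + 1, y + 1).
  by rewrite /step /=; congr pair; lia.
have [l1 h1] := stepE _ _ _ e1 ug cg.
have [l2 h2] := stepE _ _ _ e2 ng rg.
have [l3 h3] := stepE _ _ true erefl cg rg.
have [l4 h4] := stepE _ _ true erefl ug ng.
rewrite /diag /= in l1 l2 l3 l4 h1 h2 h3 h4.
have {}h1 := h1 ltac:(lia); have {}h2 := h2 ltac:(lia).
have {}h3 := h3 ltac:(lia); have {}h4 := h4 ltac:(lia).
case: (leP (x + 1 - y) e) => le_e.
  by move: h1 h4; rewrite !ifT; [move=> -> |lia|lia].
by move: h2 h3; rewrite !ifF; [move=> -> |lia|lia].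
Qed.

End LocalToGlobal.

Lemma locally_folded_semistandard e S :
  locally_folded e (entry S) -> semistandard_folded e S.
Proof.
move=> ff.
(* Position alone fixes the mark of a repeated letter, which settles both row conditions at once;
   [col] does this for columns. *)
have row c d : c != d -> same_row (val c) (val d) -> S c = S d ->
    (S c).2 = ~~ (weakly_above e (val c) && weakly_above e (val d)).
  rewrite -!entry_val -(inj_eq val_inj) /same_row /weakly_above.
  move: (valP c) (valP d); case: (val c) (val d) => [x y] [x' y'] /= cg dg.
  move=> neq /eqP eqy; subst y'.
  have [lt_x|lt_x|eqx] := ltgtP x x'; last by rewrite eqx eqxx in neq.
    by move=> /(locally_folded_row_eq ff cg dg lt_x) ->; lia.
  by move=> eq_f; rewrite eq_f (locally_folded_row_eq ff dg cg lt_x) //; lia.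
have col c d : c != d -> same_col (val c) (val d) -> S c = S d ->
    (S c).2 = weakly_above e (val c) && weakly_above e (val d).
  rewrite -!entry_val -(inj_eq val_inj) /same_col /weakly_above.
  move: (valP c) (valP d); case: (val c) (val d) => [x y] [x' y'] /= cg dg.
  move=> neq /eqP eqx; subst x'.
  have [lt_y|lt_y|eqy] := ltgtP y y'; last by rewrite eqy eqxx in neq.
    by move=> /(locally_folded_col_eq ff cg dg lt_y) ->; lia.
  by move=> eq_f; rewrite eq_f (locally_folded_col_eq ff dg cg lt_y) //; lia.
split.
- move=> c d; rewrite -!entry_val /same_row.
  move: (valP c) (valP d); case: (val c) (val d) => [x y] [x' y'] /= cg dg.
  move=> /eqP eqy lex; subst y'; have E : x' = x + `|x' - x|%N%:Z by lia.
  by rewrite E in dg *; apply: (locally_folded_row_le ff cg dg).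
- move=> c d; rewrite -!entry_val /same_col.
  move: (valP c) (valP d); case: (val c) (val d) => [x y] [x' y'] /= cg dg.
  move=> /eqP eqx ley; subst x'; have E : y' = y + `|y' - y|%N%:Z by lia.
  by rewrite E in dg *; apply: (locally_folded_col_le ff cg dg).
- by move=> c d neq r A [eqS]; rewrite /unmarked (row c d) // A.
- by move=> c d neq r A [eqS]; rewrite /marked (row c d) // A.
- by move=> c d neq r A [eqS]; rewrite /marked (col c d) // A.
- by move=> c d neq r /negPf A [eqS]; rewrite /unmarked (col c d) // A.
Qed.

(** * Sliding the free marks across the diagonals [e] and [e + 1] *)

Definition linked f (c d : cell) := (d \in gamma) && ((f c).1 == (f d).1).

(* On linked pairs of the diagonals e and e + 1, [slide_mark e true] replaces
   the marks (u, v) by (~ v, u), and [slide_mark e false] is its inverse. *)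
Definition slide_mark e (b : bool) f (c : cell) : bool :=
  if diag c == e then
    if [pick o | linked f c (step o c)] is Some o then (f (step o c)).2 (+) b
    else (f c).2
  else if diag c == e + 1 then
    if [pick o | linked f c (back o c)] is Some o then (f (back o c)).2 (+) ~~ b
    else (f c).2
  else (f c).2.

Definition slide e b S : filling gamma :=
  [ffun u => ((entry S (val u)).1, slide_mark e b (entry S) (val u))].

Lemma entry_slide e b S c : c \in gamma ->
  entry (slide e b S) c = ((entry S c).1, slide_mark e b (entry S) c).
Proof. by move=> cg; rewrite -[c]/(val [` cg]%fset) entry_val ffunE. Qed.

(** The right and lower neighbours of a cell are opposite corners of a unit square, so they cannot
    both carry its number: a ribbon has at most one next cell, and the [pick] in [slide_mark] is
    unambiguous. *)
Lemma linked_step_inj f c o o' : square_free f ->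
  linked f c (step o c) -> linked f c (step o' c) -> o = o'.
Proof.
move=> sf; wlog : o o' / o && ~~ o'.
  by case: o; case: o' => // W h h'; [apply: W | apply/esym/W].
case: o o' => -[] //= _ /andP[rg /eqP nr] /andP[dg /eqP nd].
have E : (c.1 + 1, c.2) = north_east (c.1, c.2 - 1).
  by rewrite /north_east /=; congr pair; lia.
by case: (sf (c.1, c.2 - 1)) => //; rewrite -E // -nd nr.
Qed.

Lemma linked_back_inj f c o o' : square_free f ->
  linked f c (back o c) -> linked f c (back o' c) -> o = o'.
Proof.
move=> sf; wlog : o o' / o && ~~ o'.
  by case: o; case: o' => // W h h'; [apply: W | apply/esym/W].
case: o o' => -[] //= _ /andP[rg /eqP nr] /andP[dg /eqP nd].
have E : (c.1, c.2 + 1) = north_east (c.1 - 1, c.2).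
  by rewrite /north_east /=; congr pair; lia.
by case: (sf (c.1 - 1, c.2)) => //; rewrite -E // -nd nr.
Qed.

Lemma slide_mark_step e b f o c : square_free f -> diag c = e ->
  linked f c (step o c) -> slide_mark e b f c = (f (step o c)).2 (+) b.
Proof.
move=> sf ce lo; rewrite /slide_mark ce eqxx; case: pickP => [o' lo'|/(_ o)].
  by rewrite (linked_step_inj sf lo lo').
by rewrite lo.
Qed.

Lemma slide_mark_back e b f o c : square_free f -> diag c = e + 1 ->
  linked f c (back o c) -> slide_mark e b f c = (f (back o c)).2 (+) ~~ b.
Proof.
move=> sf ce lo; rewrite /slide_mark ce eqxx ifF; last lia.
case: pickP => [o' lo'|/(_ o)]; last by rewrite lo.
by rewrite (linked_back_inj sf lo lo').
Qed.

Lemma slide_mark_off e b f c :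
  diag c <> e -> diag c <> e + 1 -> slide_mark e b f c = (f c).2.
Proof. by move=> /eqP/negPf ce /eqP/negPf ce1; rewrite /slide_mark ce ce1. Qed.

Lemma square_free_slide e b S :
  square_free (entry S) -> square_free (entry (slide e b S)).
Proof. by move=> sf c cg ng; rewrite !entry_slide //; apply: sf. Qed.

Lemma linked_slide e b S c d : c \in gamma ->
  linked (entry (slide e b S)) c d = linked (entry S) c d.
Proof.
rewrite /linked => cg; case: (boolP (d \in gamma)) => //= dg.
by rewrite !entry_slide.
Qed.

(** Links depend only on the numbers, which a slide keeps, so both slides pair the same cells. A
    mark travels to the partner cell and back, complemented both times or neither time. *)
Lemma slideK e b S : square_free (entry S) -> slide e (~~ b) (slide e b S) = S.
Proof.
move=> sf; have sfT := @square_free_slide e b S sf.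
apply/ffunP => u; rewrite ffunE; have cg := valP u; set c := val u in cg *.
rewrite -entry_val -/c entry_slide //= [RHS]surjective_pairing; congr pair.
have [ce|ce] := eqVneq (diag c) e.
  case: (pickP (fun o => linked (entry S) c (step o c))) => [o lo|no].
    have /andP[sg /eqP ns] := lo.
    rewrite (@slide_mark_step _ _ _ o) ?linked_slide // entry_slide //=.
    rewrite (@slide_mark_back _ _ _ o) ?diag_step ?ce //; last first.
      by rewrite stepK /linked cg ns eqxx.
    by rewrite stepK; case: b {sfT}; case: (_.2).
  rewrite /slide_mark ce eqxx; case: pickP => [o|_].
    by rewrite linked_slide // no.
  rewrite entry_slide //= /slide_mark ce eqxx.
  by case: pickP => // o; rewrite no.
have [ce1|ce1] := eqVneq (diag c) (e + 1); last first.
  by rewrite slide_mark_off ?entry_slide //= ?slide_mark_off //; apply/eqP.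
case: (pickP (fun o => linked (entry S) c (back o c))) => [o lo|no].
  have /andP[sg /eqP ns] := lo.
  rewrite (@slide_mark_back _ _ _ o) ?linked_slide // entry_slide //=.
  rewrite (@slide_mark_step _ _ _ o); first last.
  - by rewrite backK /linked cg ns eqxx.
  - by move: ce1; rewrite -{1}(backK o c) diag_step; lia.
  - by [].
  by rewrite backK; case: b {sfT}; case: (_.2).
rewrite /slide_mark (negPf ce) ce1 eqxx; case: pickP => [o|_].
  by rewrite linked_slide // no.
rewrite entry_slide //= /slide_mark (negPf ce) ce1 eqxx.
by case: pickP => // o; rewrite no.
Qed.

Lemma locally_folded_slide e b S :
  locally_folded (if b then e else e + 1) (entry S) ->
  locally_folded (if b then e + 1 else e) (entry (slide e b S)).
Proof.
move=> ff; have sf := locally_folded_square_free ff.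
move=> o c cg sg; have := ff o c cg sg; rewrite !entry_slide //=.
move=> [le_n mk]; split=> // eq_n; have {mk} := mk eq_n.
have lo : linked (entry S) c (step o c) by rewrite /linked sg eq_n eqxx.
have lb : linked (entry S) (step o c) (back o (step o c)).
  by rewrite stepK /linked cg eq_n eqxx.
have [ce|ce] := eqVneq (diag c) e.
  (* On this pair the determined mark changes cells and is complemented, as required: [o] on the
     second cell corresponds to [~~ o] on the first. *)
  rewrite (slide_mark_step b sf ce lo).
  rewrite (slide_mark_back b sf _ lb) ?diag_step ?ce //.
  rewrite stepK; case: b {ff}.
    by rewrite ifF ?ifT; [move=> ->; rewrite addbT|lia|lia].
  by rewrite ifT ?ifF; [move=> ->; rewrite addbT negbK|lia|lia].
(* For any other pair the determined mark sits on a cell off both diagonals, the first cell when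
   [diag c < e] and the second when [diag c > e], so the slide can only alter its free mark. *)
have [lt_ce|le_ec] := ltP (diag c) e; rewrite diag_step.
  have -> : diag c + 1 <= (if b then e else e + 1) by case: (b); lia.
  have -> : diag c + 1 <= (if b then e + 1 else e) by case: (b); lia.
  by rewrite slide_mark_off //; lia.
have -> : (diag c + 1 <= (if b then e else e + 1)) = false.
  by case: (b); lia.
have -> : (diag c + 1 <= (if b then e + 1 else e)) = false.
  by case: (b); lia.
by rewrite slide_mark_off // diag_step; lia.
Qed.

Lemma content_slide e b S : content (slide e b S) = content S.
Proof.
apply/fsfunP => i; rewrite !contentE; apply: eq_card => u; rewrite !inE.
by rewrite ffunE entry_val.
Qed.

Lemma slide_bij e : set_bij [set S | semistandard_folded e S]
  [set S | semistandard_folded (e + 1) S] (slide e true).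
Proof.
have sf e1 S : semistandard_folded e1 S -> square_free (entry S).
  by move=> /semistandard_locally_folded /locally_folded_square_free.
split.
- move=> S /= /semistandard_locally_folded ff.
  exact/locally_folded_semistandard/(locally_folded_slide (b := true)).
- move=> S S'; rewrite !inE /= => /sf sfS /sf sfS' eqS.
  by have := @slideK e true S sfS; rewrite eqS slideK.
- move=> S /= ssS; exists (slide e false S);
    last exact: (@slideK e false S (sf _ _ ssS)).
  apply/locally_folded_semistandard/(locally_folded_slide (b := false)).
  exact: semistandard_locally_folded.
Qed.

(** * Invariance of the folded Q-function *)

Lemma folded_Q_succ e : folded_Q gamma (e + 1) = folded_Q gamma e.
Proof.
apply/funext => m; rewrite /folded_Q (reindex_fsbig _ _ _ _ (slide_bij e)).
by apply: eq_fsbigr => S _; rewrite content_slide.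
Qed.

End LocalConditions.

Theorem mainTheorem13 (gamma : {fset cell}) (Hgamma : young_translate gamma)
    (e e' : int) :
  folded_Q gamma e = folded_Q gamma e'.
Proof.
have closed := young_translate_interval_closed Hgamma.
have shift k a : folded_Q gamma (a + k%:Z) = folded_Q gamma a.
  elim: k => [|k IHk]; first by rewrite addr0.
  by rewrite -addn1 PoszD addrA folded_Q_succ.
wlog le_e : e e' / e <= e'.
  by move=> W; have [/W|/ltW/W] := leP e e'.
by have -> : e' = e + `|e' - e|%N%:Z by lia.
Qed.
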